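(* Fix $C\ge1$ and $\kappa\ge1$. There are constants $0<c_1\le c_2<+\infty$, depending only on $C$ and $\kappa$, such that the following holds. Let $0<a\le A$ be reals and let $g:[0,1]^2\to\mathbb R$ satisfy: (1) $|g(z)-g(z')|\le A\|z-z'\|$ for all $z,z'\in[0,1]^2$; (2) there is $z_0\in[0,1]^2$ with $g(z_0)=0$ and, for all $z\in[0,1]^2$ and $t\in[0,1]$, $g(z)-g(z+t(z_0-z))\ge a\,t\,\|z_0-z\|$; (3) $A/a\le C$. Let $f=e^{-g}$ and let $N\ge2$ be an integer with $\kappa^{-1}A\le N\le\kappa a$. Then the spectral gap $\lambda$ of the Metropolis chain on $B_N=\{1,\dots,N\}^2$ associated with $f$ satisfies $c_1\le\lambda\le c_2$.
   Context: $\|\cdot\|$ is the Euclidean norm on $\mathbb R^2$. Given a positive function $f$ on $[0,1]^2$ and an integer $N$, define on $B_N=\{1,\dots,N\}^2$ the function $F_N(k_1,k_2)=f\left(\frac{k_1-1/2}{N},\frac{k_2-1/2}{N}\right)$ and the probability measure $\pi=F_N/\sum_{B_N}F_N$. The associated Metropolis chain (with proposal the simple random walk on the grid with holding at the boundary) is the Markov kernel $M$ on $B_N$ given by $M(\mathbf k,\mathbf l)=\frac14\min\{1,F_N(\mathbf l)/F_N(\mathbf k)\}$ if $|k_1-l_1|+|k_2-l_2|=1$, $M(\mathbf k,\mathbf l)=0$ if $|k_1-l_1|+|k_2-l_2|>1$, and $M(\mathbf k,\mathbf k)=1-\sum_{\mathbf l\ne\mathbf k}M(\mathbf k,\mathbf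 l)$. It is reversible with respect to $\pi$. The spectral gap is $\lambda=1-\beta_1$, where $\beta_1$ is the second largest eigenvalue of $M$ acting on $L^2(B_N,\pi)$. *)

(* Defs.v *)
From HB Require Import structures.
From mathcomp Require Import all_boot all_order all_algebra.
From mathcomp Require Import all_classical reals.

Set Implicit Arguments.
Unset Strict Implicit.
Unset Printing Implicit Defensive.

Import Order.TTheory GRing.Theory Num.Theory.

Local Open Scope ring_scope.

(* The norm that the libraries put on [R * R] is the sup norm. *)
Definition enorm2 (R : realType) (z : R * R) : R :=
  Num.sqrt (z.1 ^+ 2 + z.2 ^+ 2).

Definition in_unit_square (R : realType) (z : R * R) : Prop :=
  0 <= z.1 <= 1 /\ 0 <= z.2 <= 1.

Section Eigenvalues.
Variables (R : realType) (V : vectType R).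
Implicit Types (T : 'End(V)) (s : seq R) (x : R).

Definition eigenvalue_list T : set (seq R) := fun s =>
  sorted >=%R s /\ forall x, count_mem x s = \dim (passmx.leigenspace T x).

(* The real eigenvalues of [T] in nonincreasing order, each repeated according
   to the dimension of its eigenspace.  When [T] is self-adjoint for some inner
   product, as the operator of a reversible kernel is, there are [\dim {:V}]
   entries. *)
Definition eigenvalues T : seq R := xget [::] (eigenvalue_list T).

Lemma eigenvalue_list_uniq T s1 s2 :
  eigenvalue_list T s1 -> eigenvalue_list T s2 -> s1 = s2.
Proof.
move=> [s1s c1] [s2s c2]; apply: (sorted_eq _ _ s1s s2s).
- by move=> y x z /= xy yz; apply: le_trans yz xy.
- by move=> x y /andP[xy yx]; apply/le_anti/andP.
- by apply/allP => x _ /=; rewrite c1 c2.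
Qed.

Let roots_finite (p : {poly R}) :
  p != 0 -> exists s, forall x, root p x -> x \in s.
Proof.
have [n] := ubnP (size p); elim: n p => // n IHn p pn p0.
have [[x px]|nr] := pselect (exists x, root p x); last first.
  by exists [::] => x px; case: nr; exists x.
have /factor_theorem[q pE] := px.
have q0 : q != 0 by apply: contraNneq p0 => q0; rewrite pE q0 mul0r.
have [|s sq] := IHn q _ q0.
  by move: pn; rewrite pE size_Mmonic ?monicXsubC// size_XsubC addn2 ltnS.
exists (x :: s) => y; rewrite pE rootM root_XsubC inE orbC.
by case: eqP => //= _; apply: sq.
Qed.

Lemma eigenvaluesP T : eigenvalue_list T (eigenvalues T).
Proof.
suff [s sP] : exists s, eigenvalue_list T s by apply: (xgetI [::] sP).
pose p := char_poly (passmx.mxof (vbasis {:V}) (vbasis {:V}) T).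
have [|s sP] := @roots_finite p; first exact/monic_neq0/char_poly_monic.
have eig x : passmx.leigenspace T x != 0%VS -> x \in s.
  move=> Tx; apply: sP; rewrite /p -eigenvalue_root_char.
  rewrite (passmx.leigenspaceE (vbasisP _)) in Tx.
  by apply: contraNneq Tx => e0; rewrite e0 (passmx.vsof_eq0 (vbasisP _)).
pose r := flatten [seq nseq (\dim (passmx.leigenspace T x)) x | x <- undup s].
exists (sort >=%R r); split.
  by apply: sort_sorted => x y /=; apply: le_total.
move=> x; rewrite (permP (permEl (perm_sort _ _))) /r count_flatten -map_comp.
rewrite sumnE big_map (eq_bigr (fun y => if y == x then
  \dim (passmx.leigenspace T x) else 0%N)); last first.
  by move=> y _ /=; rewrite count_nseq /=; case: eqP => [->|_]; rewrite ?mul1n.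
have [Tx0|Tx0] := eqVneq (passmx.leigenspace T x) 0%VS.
  by rewrite Tx0 dimv0 big1// => y _; case: ifP.
rewrite (bigD1_seq x) ?undup_uniq ?mem_undup ?eig//= eqxx.
by rewrite big1 ?addn0// => y /negPf ->.
Qed.

End Eigenvalues.

Section Markov.
Variables (R : realType) (S : finType).
Implicit Types (M : S -> S -> R) (h : {ffun S -> R^o}).

(* [M] acts on all functions on [S]: this is the vector space underlying
   L^2(S, pi) for every everywhere positive measure [pi]. *)
Definition kernel_fun M h : {ffun S -> R^o} := [ffun k => \sum_l M k l * h l].

Fact kernel_fun_is_linear M : linear (kernel_fun M).
Proof.
move=> a u v; apply/ffunP => k; rewrite !ffunE scaler_sumr -big_split/=.
by apply: eq_bigr => l _; rewrite !ffunE mulrDr scalerAr.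
Qed.

HB.instance Definition _ M :=
  GRing.isLinear.Build R {ffun S -> R^o} {ffun S -> R^o} _ (kernel_fun M)
    (kernel_fun_is_linear M).

Definition kernel_op M : 'End({ffun S -> R^o}) := linfun (kernel_fun M).

Lemma kernel_opE M h k : kernel_op M h k = \sum_l M k l * h l.
Proof. by rewrite lfunE ffunE. Qed.

(* The list is numbered from 0, so the entry 1 is the second largest. *)
Definition spectral_gap M : R := 1 - (eigenvalues (kernel_op M))`_1.

End Markov.

Section Metropolis.
Variables (R : realType) (N : nat).
Implicit Types (f : R * R -> R) (k l : 'I_N * 'I_N).

(* [k : 'I_N] stands for the coordinate [k.+1] in {1, ..., N}. *)
Definition grid_fun f k : R :=
  f ((k.1.+1%:R - 2^-1) / N%:R, (k.2.+1%:R - 2^-1) / N%:R).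

Definition grid_measure f k : R := grid_fun f k / \sum_l grid_fun f l.

Definition grid_dist k l : nat := (`|k.1 - l.1| + `|k.2 - l.2|)%N.

Definition metropolis_off f k l : R :=
  if grid_dist k l == 1%N then
    4^-1 * Num.min 1 (grid_fun f l / grid_fun f k)
  else 0.

Definition metropolis f k l : R :=
  if l == k then 1 - \sum_(l' | l' != k) metropolis_off f k l'
  else metropolis_off f k l.

Lemma metropolis_reversible f k l : (forall l', 0 < grid_fun f l') ->
  grid_measure f k * metropolis f k l = grid_measure f l * metropolis f l k.
Proof.
move=> f0; rewrite /metropolis eq_sym; case: eqVneq => [->//|_].
rewrite /metropolis_off /grid_dist distnC (distnC l.2).
case: ifP => [_|_]; last by rewrite !mulr0.
have minE x y : 0 < x -> x * Num.min 1 (y / x) = Num.min x y :> R.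
  by move=> x0; rewrite minr_pMr ?ltW// mulr1 mulrC divfK ?gt_eqF.
rewrite /grid_measure ![4^-1 * _]mulrC !mulrA; set Z := \sum_l' _.
rewrite ![_ / Z * _]mulrAC.
by rewrite !minE// minC.
Qed.

End Metropolis.

(* Main.v *)
(** Since a/N >= 1/kappa and A/N <= kappa, a lattice path that follows the segment
from k to z0 up to rounding decreases g at a linear rate in the number j of steps,
up to an additive constant; hence F(k) <= E exp(- c j) F(v) for the j-th vertex v of
the path, with E and c depending only on kappa.  Writing h(k) - h(r), with r a
lattice point nearest to z0, as a sum of increments along the path, the
Cauchy-Schwarz inequality with geometric weights and this decay give a Poincare
inequality whose constant depends only on kappa: the vertices k whose j-th path
vertex is v lie within distance j of v, so that half of the decay pays for the sum
over k.  The upper bound only uses that the eigenvalues of a stochastic matrix lie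
in [-1, 1]. *)

Require Import Defs.
From mathcomp Require Import all_boot all_order all_algebra.
From mathcomp Require Import all_classical reals sequences exp.
From mathcomp Require Import ring lra zify.

Set Implicit Arguments.
Unset Strict Implicit.
Unset Printing Implicit Defensive.

Import Order.TTheory GRing.Theory Num.Theory.

Local Open Scope ring_scope.

(** * From a Poincare inequality to the spectral gap of a reversible kernel *)

Section SpectralGap.
Variables (R : realType) (S : finType) (M : S -> S -> R).
Hypothesis M_ge0 : forall k l, 0 <= M k l.
Hypothesis M_row : forall k, \sum_l M k l = 1.

Lemma kernel_eigenP x (h : {ffun S -> R^o}) :
  h \in passmx.leigenspace (kernel_op M) x <->
  forall k, \sum_l M k l * h l = x * h k.
Proof.
rewrite memv_ker add_lfunE opp_lfunE scale_lfunE id_lfunE subr_eq0.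
split=> [/eqP E k|E]; first by rewrite -kernel_opE E !ffunE.
by apply/eqP/ffunP => k; rewrite kernel_opE !ffunE E.
Qed.

Lemma ffun_neq0 (h : {ffun S -> R^o}) : h != 0 -> exists k, h k != 0.
Proof.
move=> h0; apply/existsP; apply: contraNT h0; rewrite negb_exists => /forallP h0.
by apply/eqP/ffunP => k; apply/eqP; rewrite ffunE -[_ == _]negbK h0.
Qed.

(** Read the eigenvalue equation at a point where [|h|] is maximal: averaging over a stochastic row
    cannot exceed this maximum. *)
Lemma stochastic_eigenvalue_norm_le1 x :
  passmx.leigenspace (kernel_op M) x != 0%VS -> `|x| <= 1.
Proof.
rewrite -vpick0; move: (memv_pick (passmx.leigenspace (kernel_op M) x)).
move: (vpick _) => h /kernel_eigenP hx /ffun_neq0[k0 hk0].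
case: (@Order.TotalTheory.arg_maxP _ _ _ k0 xpredT (fun k => `|h k : R|)) => // k _ max_k.
have kmax l : `|h l : R| <= `|h k : R| := max_k l isT.
have hk_gt0 : 0 < `|h k : R|.
  by rewrite (lt_le_trans _ (kmax k0)) ?normr_gt0.
rewrite -(ler_pM2r hk_gt0) mul1r -normrM -hx -[leRHS]mul1r -(M_row k) mulr_suml.
apply: le_trans (ler_norm_sum _ _ _) _; apply: ler_sum => l _.
by rewrite normrM (ger0_norm (M_ge0 k l)) ler_wpM2l// kmax.
Qed.

Lemma eigenvalues_leigenspace x :
  x \in eigenvalues (kernel_op M) -> passmx.leigenspace (kernel_op M) x != 0%VS.
Proof.
have [_ cnt] := eigenvaluesP (kernel_op M).
by rewrite -has_pred1 has_count cnt lt0n dimv_eq0.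
Qed.

(* A list of at most one eigenvalue has entry 1 equal to the default value 0, which
   is harmless for both bounds on the gap. *)
Lemma stochastic_spectral_gap_le2 : spectral_gap M <= 2.
Proof.
rewrite /spectral_gap; have [s1|s1] := leqP (size (eigenvalues (kernel_op M))) 1.
  by rewrite nth_default//; lra.
have := mem_nth 0 s1 => /eigenvalues_leigenspace.
by move/stochastic_eigenvalue_norm_le1; rewrite ler_norml => /andP[]; lra.
Qed.

Variables (w : S -> R) (K : R) (r : S).
Hypothesis w_gt0 : forall k, 0 < w k.
Hypothesis w_rev : forall k l, w k * M k l = w l * M l k.
Hypothesis K_gt0 : 0 < K.
Hypothesis poincare : forall h : S -> R,
  \sum_k w k * (h k - h r) ^+ 2 <=
  K * \sum_k \sum_l w k * M k l * (h k - h l) ^+ 2.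

Lemma reversible_stationary (h : S -> R) :
  \sum_k w k * \sum_l M k l * h l = \sum_k w k * h k.
Proof.
under eq_bigr do rewrite mulr_sumr.
rewrite exchange_big; apply: eq_bigr => l _ /=.
under eq_bigr do rewrite mulrA w_rev.
by rewrite -mulr_suml -mulr_sumr M_row mulr1.
Qed.

(** Expand the square; the terms in [h l ^+ 2] are summed by stationarity. The sum runs over ordered
    pairs, whence the factor [2]. *)
Lemma dirichlet_eigen x (h : S -> R) :
  (forall k, \sum_l M k l * h l = x * h k) ->
  \sum_k \sum_l w k * M k l * (h k - h l) ^+ 2 =
  2 * (1 - x) * \sum_k w k * h k ^+ 2.
Proof.
move=> hx.
transitivity (\sum_k (w k * h k ^+ 2 - 2 * x * (w k * h k ^+ 2))
   + \sum_k w k * \sum_l M k l * h l ^+ 2); last first.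
  by rewrite reversible_stationary sumrB -mulr_sumr; ring.
rewrite -big_split; apply: eq_bigr => k _ /=.
transitivity (w k * h k ^+ 2 * \sum_l M k l - 2 * w k * h k * (\sum_l M k l * h l)
   + w k * \sum_l M k l * h l ^+ 2); last by rewrite M_row hx; ring.
rewrite !mulr_sumr -sumrB -big_split; apply: eq_bigr => l _ /=; ring.
Qed.

(** At eigenvalue 1 the Dirichlet sum vanishes, so [poincare] forces [h k = h r] for all [k]. This
    simplicity keeps entry 1 of the list away from 1. *)
Lemma leigenspace1_sub_const :
  (passmx.leigenspace (kernel_op M) 1 <= <[ [ffun=> 1 : R^o] ]>)%VS.
Proof.
apply/subvP => h /kernel_eigenP hx; apply/vlineP; exists (h r).
apply/ffunP => k; rewrite !ffunE /GRing.scale/= mulr1.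
have := poincare h; rewrite (dirichlet_eigen hx) subrr mulr0 mul0r mulr0.
have ge0 k' : 0 <= w k' * (h k' - h r : R) ^+ 2 by rewrite mulr_ge0 ?sqr_ge0 ?ltW.
rewrite le_eqVlt ltNge sumr_ge0 // orbF => /eqP/psumr_eq0P => /(_ (fun k _ => ge0 k)).
by move=> /(_ k isT)/eqP; rewrite mulf_eq0 gt_eqF//= sqrf_eq0 subr_eq0 => /eqP.
Qed.

(** An eigenfunction for [x != 1] has [w]-mean zero, so centring it at [h r] can only increase its
    weighted square norm, and [poincare] yields [1 <= 2 * K * (1 - x)]. The [1] in the minimum
    covers a list with fewer than two entries. *)
Lemma spectral_gap_poincare : Num.min 1 (2 * K)^-1 <= spectral_gap M.
Proof.
rewrite /spectral_gap; set s := eigenvalues (kernel_op M).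
have [s1|s1] := leqP (size s) 1.
  by rewrite nth_default// subr0 ge_min lexx.
rewrite ge_min; apply/orP; right.
have xs := mem_nth 0 s1; have xN := eigenvalues_leigenspace xs.
(* If entry 1 were 1, then so would be entry 0, since the list is nonincreasing and bounded by 1;
   this contradicts simplicity. *)
have [x1|x1] := eqVneq s`_1 1.
  have s0 : s`_0 = 1.
    apply: le_anti; rewrite (le_trans (ler_norm _)); last first.
      apply/stochastic_eigenvalue_norm_le1/eigenvalues_leigenspace/mem_nth.
      exact: ltn_trans s1.
    have [s_sorted _] := eigenvaluesP (kernel_op M).
    rewrite -[leLHS]x1 /=.
    by move: s_sorted s1; rewrite -/s; case: (s) => [|? []]//= ? ? /andP[].
  have [_ /(_ 1)] := eigenvaluesP (kernel_op M); rewrite -/s => cnt.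
  have := dimvS leigenspace1_sub_const.
  rewrite -cnt dim_vline; move: s0 x1 s1; case: (s) => [|? []]//= ? ? -> -> _.
  by rewrite eqxx; case: (_ != 0).
move: xN; rewrite -vpick0; move: (memv_pick (passmx.leigenspace (kernel_op M) s`_1)).
move: (vpick _) => h; move: (s`_1) x1 => x x1 /kernel_eigenP hx /ffun_neq0[k0 hk0].
(* Stationarity multiplies the mean by [x], and [x != 1]. *)
have mean0 : \sum_k w k * (h k : R) = 0.
  have := reversible_stationary h; under eq_bigr do rewrite hx mulrCA.
  rewrite -mulr_sumr => /eqP; rewrite -subr_eq0 -[X in _ - X]mul1r -mulrBl.
  by rewrite mulf_eq0 subr_eq0 (negPf x1) => /eqP.
have norm_gt0 : 0 < \sum_k w k * (h k : R) ^+ 2.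
  rewrite (bigD1 k0)//= ltr_wpDr//; last first.
    by rewrite mulr_gt0// exprn_even_gt0.
  by apply: sumr_ge0 => k _; rewrite mulr_ge0 ?sqr_ge0 ?ltW.
have := poincare h; rewrite (dirichlet_eigen hx).
have -> : \sum_k w k * (h k - h r : R) ^+ 2 = \sum_k w k * (h k : R) ^+ 2
    - 2 * (h r : R) * (\sum_k w k * (h k : R)) + (\sum_k w k) * (h r : R) ^+ 2.
  rewrite mulr_sumr mulr_suml -sumrB -big_split; apply: eq_bigr => k _ /=; ring.
rewrite mean0 mulr0 subr0 => le1.
have wr : 0 <= (\sum_k w k) * (h r : R) ^+ 2.
  by rewrite mulr_ge0 ?sqr_ge0// sumr_ge0// => k _; exact: ltW.
have := le_trans (ler_wpDr wr (lexx _)) le1.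
rewrite !mulrA -[leLHS]mul1r ler_pM2r// => le2.
rewrite -[_^-1]mulr1 ler_pdivrMl ?mulr_gt0//; lra.
Qed.

End SpectralGap.

(** * Sums with geometric weights *)

Lemma geometric_sum_le (R : realType) (q : R) J : 0 < q -> q < 1 ->
  \sum_(j < J) q ^+ j <= (1 - q)^-1.
Proof.
move=> q0 q1; rewrite -[_^-1]mulr1 ler_pdivlMl ?subr_gt0//.
suff -> : (1 - q) * \sum_(j < J) q ^+ j = 1 - q ^+ J.
  by rewrite gerBl exprn_ge0 ?ltW.
elim: J => [|J IH]; first by rewrite big_ord0 expr0; ring.
by rewrite big_ord_recr/= mulrDr IH exprS; ring.
Qed.

Lemma two_sided_geometric_sum (R : realType) (q : R) (N m : nat) : 0 < q -> q < 1 ->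
  \sum_(i < N) q ^+ `|i - m|%N <= 2 / (1 - q).
Proof.
move=> q0 q1; rewrite ler_pdivlMr ?subr_gt0// mulrC.
(* The bound is sharpened for the induction on [N]: up to [m] it is the last summand, beyond [m] it
   is 2 minus [1 - q] times the tail still missing. *)
suff /le_trans : (1 - q) * \sum_(i < N) q ^+ `|i - m|%N <=
    if (N <= m)%N then q ^+ (m - N).+1 else 2 - q ^+ (N - m).
  apply; case: ifP => _; last by rewrite gerBl exprn_ge0 ?ltW.
  by apply: (@le_trans _ _ 1); rewrite ?ler1n// exprn_ile1// ltW.
elim: N => [|N IH]; first by rewrite big_ord0 mulr0 exprn_ge0 ?ltW.
rewrite big_ord_recr/= mulrDr.
case: (ltngtP N m) IH => [Nm|mN|->] IH.
- rewrite (distnEr (ltnW Nm)).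
  rewrite -(subnSK Nm) in IH *; rewrite !exprS in IH *; lra.
- rewrite (distnEl (ltnW mN)) (subSn (ltnW mN)) exprS; lra.
- by move: IH; rewrite distnn subSnn subnn expr0 expr1; lra.
Qed.

(* Cauchy-Schwarz for the weights [q ^+ j], proved by peeling off the first term
   with [(x + y)^2 <= x^2 / (1 - q) + y^2 / q]. *)
Lemma sqr_sum_geometric (R : realType) (q : R) (d : nat -> R) J :
  0 < q -> q < 1 ->
  (\sum_(j < J) d j) ^+ 2 <= (1 - q)^-1 * \sum_(j < J) q ^- j * d j ^+ 2.
Proof.
move=> q0 q1; have p0 : 0 < 1 - q by rewrite subr_gt0.
elim: J d => [|J IH] d; first by rewrite !big_ord0 expr0n/= mulr0.
rewrite !big_ord_recl expr0 invr1 mul1r.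
have -> : \sum_(i < J) q ^- bump 0 i * d (bump 0 i) ^+ 2 =
    q^-1 * \sum_(i < J) q ^- i * d i.+1 ^+ 2.
  by rewrite mulr_sumr; apply: eq_bigr => i _; rewrite /bump add1n exprS invfM mulrA.
have := IH (fun j => d j.+1); set s := (\sum_(i < J) d i.+1).
set T := \sum_(i < J) _; set x := d _ => sT.
have : (x + s) ^+ 2 <= (1 - q)^-1 * x ^+ 2 + q^-1 * s ^+ 2.
  rewrite -(@subr_ge0 R).
  suff -> : (1 - q)^-1 * x ^+ 2 + q^-1 * s ^+ 2 - (x + s) ^+ 2 =
    q^-1 * (1 - q)^-1 * (q * x - (1 - q) * s) ^+ 2.
    by rewrite mulr_ge0 ?sqr_ge0// mulr_ge0 ?invr_ge0 ?ltW.
  by field; rewrite !gt_eqF.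
move=> /le_trans; apply; rewrite mulrDr lerD2l [leRHS]mulrCA.
by rewrite ler_pM2l ?invr_gt0.
Qed.

(** * A weighted path argument for Poincare inequalities *)

Section PathPoincare.
Variables (R : realType) (S : finType) (w : S -> R) (Q e : S -> S -> R).
Variables (p : S -> nat -> S) (r : S) (J : nat) (B D q : R).
Hypothesis q_gt0 : 0 < q.
Hypothesis q_lt1 : q < 1.
Hypothesis D_ge0 : 0 <= D.
Hypothesis w_ge0 : forall k, 0 <= w k.
Hypothesis Q_ge0 : forall v v', 0 <= Q v v'.
Hypothesis e_ge0 : forall k v, 0 <= e k v.
Hypothesis e_sum : forall v, \sum_k e k v <= B.
Hypothesis p0 : forall k, p k 0 = k.
Hypothesis pJ : forall k, p k J = r.
Hypothesis p_weight : forall k j, (j < J)%N -> p k j != p k j.+1 ->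
  w k <= D * q ^+ j ^+ 2 * e k (p k j) * Q (p k j) (p k j.+1).

(** In [p_weight], one factor [q ^+ j] cancels the weight [q ^- j] from Cauchy-Schwarz and the other
    makes the sum over [j] converge. The kernel [e] replaces a count of the paths whose [j]-th
    vertex is [v]: its sum over [k] is at most [B]. *)
Lemma path_poincare (h : S -> R) :
  \sum_k w k * (h k - h r) ^+ 2 <=
  D * B / (1 - q) ^+ 2 * \sum_v \sum_v' Q v v' * (h v - h v') ^+ 2.
Proof.
set E := \sum_v \sum_v' _.
pose d k j := h (p k j) - h (p k j.+1).
have dirichlet_ge0 v : 0 <= \sum_v' Q v v' * (h v - h v') ^+ 2.
  by apply: sumr_ge0 => v' _; rewrite mulr_ge0 ?sqr_ge0.
have step (j : 'I_J) : \sum_k w k * d k j ^+ 2 <= D * q ^+ j ^+ 2 * (B * E).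
  have Dq : 0 <= D * q ^+ j ^+ 2 by rewrite mulr_ge0// !exprn_ge0// ltW.
  apply: (@le_trans _ _ (\sum_k D * q ^+ j ^+ 2 *
      \sum_v e k v * \sum_v' Q v v' * (h v - h v') ^+ 2)).
    apply: ler_sum => k _.
    apply: (@le_trans _ _ (D * q ^+ j ^+ 2 *
      (e k (p k j) * (Q (p k j) (p k j.+1) * d k j ^+ 2)))).
      (* An idle step has zero increment, so [p_weight] is needed only for moving steps. *)
      have [eqp|neqp] := eqVneq (p k j) (p k j.+1).
        by rewrite /d eqp subrr expr0n/= !mulr0.
      rewrite (mulrA (e _ _)) (mulrA (D * _)) ler_wpM2r ?sqr_ge0// mulrA.
      exact: p_weight.
    apply: ler_wpM2l => //.
    (* The single edge of the path is enlarged to all pairs [(v, v')]; the sum over [k] then meets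
       only [e]. *)
    rewrite (bigD1 (p k j))//= ler_wpDr//; last first.
      apply: ler_wpM2l => //; rewrite (bigD1 (p k j.+1))//= ler_wpDr//.
      by apply: sumr_ge0 => v' _; rewrite mulr_ge0 ?sqr_ge0.
    by apply: sumr_ge0 => v _; rewrite mulr_ge0.
  rewrite -mulr_sumr ler_wpM2l// exchange_big/= /E mulr_sumr.
  by apply: ler_sum => v _; rewrite -mulr_suml ler_wpM2r.
have inv_ge0 : 0 <= (1 - q)^-1 by rewrite invr_ge0 subr_ge0 ltW.
have BE_ge0 : 0 <= B * E.
  rewrite mulr_ge0//; last exact: sumr_ge0.
  exact: le_trans (sumr_ge0 _ (fun k _ => e_ge0 k r)) (e_sum r).
apply: (@le_trans _ _ (\sum_k (1 - q)^-1 * \sum_(j < J) q ^- j * (w k * d k j ^+ 2))).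
  apply: ler_sum => k _.
  have -> : h k - h r = \sum_(j < J) d k j.
    rewrite -{1}(p0 k) -(pJ k) /d; elim: J => [|i IH].
      by rewrite big_ord0 subrr.
    rewrite big_ord_recr/= -IH; ring.
  apply: le_trans (ler_wpM2l (w_ge0 k) (sqr_sum_geometric _ _ q_gt0 q_lt1)) _.
  rewrite mulrCA ler_wpM2l// mulr_sumr.
  by apply: ler_sum => j _; rewrite mulrCA.
rewrite -mulr_sumr exchange_big/=.
apply: (@le_trans _ _ ((1 - q)^-1 * \sum_(j < J) D * (B * E) * q ^+ j)).
  rewrite ler_wpM2l//; apply: ler_sum => j _.
  rewrite -mulr_sumr.
  have qj : 0 < q ^+ j by rewrite exprn_gt0.
  rewrite mulrC ler_pdivrMr//; apply: le_trans (step j) _; rewrite le_eqVlt.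
  by apply/orP; left; apply/eqP; ring.
rewrite -mulr_sumr.
apply: (@le_trans _ _ ((1 - q)^-1 * (D * (B * E) * (1 - q)^-1))).
  rewrite ler_wpM2l// ler_wpM2l//; first exact: mulr_ge0.
  exact: geometric_sum_le.
by rewrite expr2 invfM le_eqVlt; apply/orP; left; apply/eqP; ring.
Qed.

End PathPoincare.

(** * Lattice paths that follow a segment *)

(** Integer part of the linear interpolation from [a] to [b] in [n] steps; the truncated subtraction
    and [minn] freeze it at [b] for [i >= n]. *)
Definition lattice_line (a b n i : nat) : nat :=
  ((a * (n - i) + b * minn i n) %/ n)%N.

Section LatticeLine.
Local Open Scope nat_scope.
Implicit Types a b n i : nat.

Lemma lattice_line_floor a b n i : 0 < n -> i <= n ->
  lattice_line a b n i * n <= a * (n - i) + b * i < (lattice_line a b n i).+1 * n.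
Proof.
by move=> n0 le_in; rewrite /lattice_line (minn_idPl le_in) leq_divM ltn_ceil.
Qed.

Lemma lattice_line0 a b n : 0 < n -> lattice_line a b n 0 = a.
Proof. by move=> n0; rewrite /lattice_line subn0 min0n muln0 addn0 mulnK. Qed.

Lemma lattice_line_end a b n i : 0 < n -> n <= i -> lattice_line a b n i = b.
Proof.
move=> n0 le_ni; rewrite /lattice_line (minn_idPr le_ni).
by move: (le_ni); rewrite -subn_eq0 => /eqP ->; rewrite muln0 mulnK.
Qed.

Lemma lattice_line_lt a b n i N : 0 < n -> a < N -> b < N ->
  lattice_line a b n i < N.
Proof.
move=> n0 aN bN; have [le_in|/ltnW ni] := leqP i n; last by rewrite lattice_line_end.
have /andP[le1 _] := lattice_line_floor a b n0 le_in; nia.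
Qed.

(** One step changes the numerator by [b - a], less than [n] in absolute value, so its quotient by
    [n] moves by at most one. *)
Lemma lattice_line_step a b n i : `|a - b| < n ->
  `|lattice_line a b n i - lattice_line a b n i.+1| <= 1.
Proof.
move=> abn; have n0 : 0 < n by apply: leq_ltn_trans abn.
have [ni|le_in] := leqP n i; first by rewrite !lattice_line_end ?distnn// leqW.
have /andP[l1 l2] := lattice_line_floor a b n0 (ltnW le_in).
have /andP[l3 l4] := lattice_line_floor a b n0 le_in.
have E : a * (n - i) + b * i + b = a * (n - i.+1) + b * i.+1 + a.
  by rewrite -(subnSK le_in); lia.
move: (lattice_line a b n i) (lattice_line a b n i.+1) l1 l2 l3 l4 => x y.
move: (a * (n - i) + b * i) (a * (n - i.+1) + b * i.+1) E => u v.
move=> E l1 l2 l3 l4; nia.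
Qed.

Lemma lattice_line_dist a b n i : `|a - b| < n -> `|a - lattice_line a b n i| <= i.
Proof.
move=> abn; have n0 : 0 < n by apply: leq_ltn_trans abn.
elim: i => [|i IH]; first by rewrite lattice_line0 ?distnn.
have := lattice_line_step i abn; move: IH; lia.
Qed.

End LatticeLine.

Section LatticePath.
Variables (N : nat) (r : 'I_N * 'I_N).
Implicit Types (k l : 'I_N * 'I_N) (j : nat).

(* The path alternates horizontal and vertical moves, so that one step changes
   at most one coordinate; both coordinates interpolate linearly, up to rounding,
   over [grid_dist k r + 1] moves of each kind, and the path then stays at [r]. *)
Definition lattice_path k j : 'I_N * 'I_N :=
  (insubd k.1 (lattice_line k.1 r.1 (grid_dist k r).+1 (uphalf j)),
   insubd k.2 (lattice_line k.2 r.2 (grid_dist k r).+1 j./2)).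

Lemma lattice_path1E k j : ((lattice_path k j).1 : nat) =
  lattice_line k.1 r.1 (grid_dist k r).+1 (uphalf j).
Proof. by rewrite val_insubd ifT// lattice_line_lt. Qed.

Lemma lattice_path2E k j : ((lattice_path k j).2 : nat) =
  lattice_line k.2 r.2 (grid_dist k r).+1 j./2.
Proof. by rewrite val_insubd ifT// lattice_line_lt. Qed.

Lemma grid_dist_eq0 k l : grid_dist k l = 0%N -> k = l.
Proof.
move=> /eqP; rewrite addn_eq0 !distn_eq0 => /andP[/eqP e1 /eqP e2].
by rewrite [k]surjective_pairing [l]surjective_pairing (val_inj e1) (val_inj e2).
Qed.

Lemma grid_dist1_lt k : (`|k.1 - r.1| < (grid_dist k r).+1)%N.
Proof. by rewrite ltnS leq_addr. Qed.

Lemma grid_dist2_lt k : (`|k.2 - r.2| < (grid_dist k r).+1)%N.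
Proof. by rewrite ltnS leq_addl. Qed.

Lemma lattice_path0 k : lattice_path k 0 = k.
Proof.
by apply: grid_dist_eq0; rewrite /grid_dist lattice_path1E lattice_path2E !lattice_line0 ?distnn.
Qed.

Lemma lattice_path_end k j :
  (2 * (grid_dist k r).+1 <= j)%N -> lattice_path k j = r.
Proof.
move=> kj; apply: grid_dist_eq0.
by rewrite /grid_dist lattice_path1E lattice_path2E !lattice_line_end ?distnn//; lia.
Qed.

Lemma lattice_path_step k j :
  (grid_dist (lattice_path k j) (lattice_path k j.+1) <= 1)%N.
Proof.
rewrite /grid_dist !lattice_path1E !lattice_path2E.
have := lattice_line_step j./2 (grid_dist1_lt k).
have := lattice_line_step j./2 (grid_dist2_lt k).
by rewrite /= uphalf_half; case: (odd j); rewrite ?add1n ?add0n ?distnn ?addn0.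
Qed.

Lemma lattice_path_dist k j : (grid_dist k (lattice_path k j) <= j)%N.
Proof.
rewrite /grid_dist !lattice_path1E !lattice_path2E.
have := lattice_line_dist (uphalf j) (grid_dist1_lt k).
have := lattice_line_dist j./2 (grid_dist2_lt k).
move: (odd_double_half j); rewrite uphalf_half; lia.
Qed.

Lemma grid_dist_lt k : (grid_dist k r < 2 * N)%N.
Proof.
rewrite /grid_dist; have := ltn_ord k.1; have := ltn_ord k.2.
have := ltn_ord r.1; have := ltn_ord r.2; lia.
Qed.

End LatticePath.

(** * The Metropolis kernel and its edge flow *)

Lemma card_grid_sphere1 N (k : 'I_N * 'I_N) :
  (#|[set l | grid_dist k l == 1%N]| <= 4)%N.
Proof.
(* A neighbour is determined by the sign of its move and by the coordinate that it keeps. *)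
pose side (l : 'I_N * 'I_N) := ((k.1 + k.2 < l.1 + l.2)%N, k.1 == l.1).
rewrite -(_ : #|{: bool * bool}| = 4%N); last by rewrite card_prod card_bool.
rewrite -(card_in_imset (f := side)) ?max_card// => l l'.
rewrite !inE /grid_dist => /eqP kl /eqP kl' [].
rewrite -!(inj_eq val_inj) => /= s1 s2; apply: grid_dist_eq0; rewrite /grid_dist.
move: s1 s2 kl kl'; lia.
Qed.

Section MetropolisKernel.
Variables (R : realType) (N : nat) (f : R * R -> R).
Hypothesis f_gt0 : forall k, 0 < @grid_fun R N f k.
Implicit Types k l : 'I_N * 'I_N.

Lemma metropolis_row k : \sum_l metropolis f k l = 1.
Proof.
rewrite (bigD1 k)//= [metropolis f k k]/metropolis eqxx.
by under [X in _ + X]eq_bigr => l /negPf lk do rewrite /metropolis lk; rewrite subrK.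
Qed.

Lemma metropolis_off_ge0 k l : 0 <= metropolis_off f k l.
Proof.
rewrite /metropolis_off; case: ifP => // _.
by rewrite mulr_ge0 ?invr_ge0// le_min ler01 divr_ge0// ltW.
Qed.

Lemma metropolis_ge0 k l : 0 <= metropolis f k l.
Proof.
rewrite /metropolis; case: ifP => // _; last exact: metropolis_off_ge0.
rewrite subr_ge0.
apply: (@le_trans _ _ (\sum_(l in [set l | grid_dist k l == 1%N]) 4^-1)).
  rewrite [leRHS]big_mkcond [leLHS]big_mkcond; apply: ler_sum => l' _.
  rewrite inE /metropolis_off; case: ifP => _; case: ifP => _ //.
  - by rewrite ler_piMr ?invr_ge0// ge_min lexx.
  - by rewrite invr_ge0.
rewrite sumr_const -[_ *+ _]mulr_natr mulrC ler_pdivrMr// mul1r ler_nat.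
exact: card_grid_sphere1.
Qed.

(** In this symmetric form, bounding the weights of both endpoints from below bounds the flow
    through the edge. *)
Lemma metropolis_flow k l : grid_dist k l = 1%N ->
  grid_fun f k * metropolis f k l = 4^-1 * Num.min (grid_fun f k) (grid_fun f l).
Proof.
move=> kl; rewrite /metropolis /metropolis_off kl eqxx.
have /negPf -> : l != k.
  by apply: contra_eq_neq kl => ->; rewrite /grid_dist !distnn.
by rewrite mulrCA minr_pMr ?ltW// mulr1 mulrCA divff ?gt_eqF// mulr1.
Qed.

Lemma metropolis_grid_fun_reversible k l :
  grid_fun f k * metropolis f k l = grid_fun f l * metropolis f l k.
Proof.
have Z0 : 0 < \sum_l0 @grid_fun R N f l0.
  rewrite (bigD1 k)//= ltr_wpDr//.
  by apply: sumr_ge0 => l' _; exact: ltW.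
have := @metropolis_reversible R N f k l f_gt0; rewrite /grid_measure.
by rewrite !(mulrAC _ _^-1) => /(mulIf _); apply; rewrite invr_eq0 gt_eqF.
Qed.

End MetropolisKernel.

(** * Norm comparison and rounding errors *)

Lemma enorm2_le_norm1 (R : realType) (z : R * R) : enorm2 z <= `|z.1| + `|z.2|.
Proof.
rewrite /enorm2 -[leRHS]ger0_norm ?addr_ge0// -sqrtr_sqr ler_sqrt ?sqr_ge0//.
rewrite sqrrD !real_normK ?num_real// -addrA lerD2l lerDr.
by rewrite mulrn_wge0// mulr_ge0.
Qed.

Lemma norm1_le_enorm2 (R : realType) (z : R * R) : `|z.1| + `|z.2| <= 2 * enorm2 z.
Proof.
have le_sqrt (x y : R) : `|x| <= Num.sqrt (x ^+ 2 + y ^+ 2).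
  by rewrite -sqrtr_sqr ler_sqrt ?addr_ge0 ?sqr_ge0// lerDl sqr_ge0.
have le2 := le_sqrt z.2 z.1; rewrite addrC in le2.
by rewrite mulr_natl mulr2n lerD ?le_sqrt.
Qed.

(** Rounding down costs at most 1, and so does the possible lag between [i] and [i']. The lag lets
    both coordinates of a path share one time parameter. *)
Lemma lattice_line_approx (R : realType) (a b n i i' : nat) :
  (`|a - b| < n)%N -> (i <= i' <= i.+1)%N -> (i' <= n)%N ->
  `|(lattice_line a b n i')%:R - (a%:R + i%:R / n%:R * (b%:R - a%:R)) : R| <= 2.
Proof.
move=> abn /andP[ii' i'i] i'n; have n0 : (0 < n)%N by apply: leq_ltn_trans abn.
have /andP[] := lattice_line_floor a b n0 i'n.
move: (lattice_line a b n i') => x.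
rewrite -(ler_nat R) -(ltr_nat R) !natrD !natrM natrB// -addn1 natrD => le1 lt2.
have nR : 0 < n%:R :> R by rewrite ltr0n.
rewrite -(ler_pM2r nR) -[X in _ * X <= _](ger0_norm (ltW nR)) -normrM.
have -> : (x%:R - (a%:R + i%:R / n%:R * (b%:R - a%:R))) * n%:R =
  x%:R * n%:R - a%:R * n%:R - i%:R * (b%:R - a%:R) :> R by field; rewrite gt_eqF.
have ba1 : a%:R <= b%:R + n%:R :> R by rewrite -natrD ler_nat; lia.
have ba2 : b%:R <= a%:R + n%:R :> R by rewrite -natrD ler_nat; lia.
have [ei|ei] : i' = i \/ i' = i.+1 by lia.
- by rewrite ei in le1 lt2; rewrite ler_norml; lra.
- by rewrite ei -addn1 natrD in le1 lt2; rewrite ler_norml; lra.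
Qed.

Lemma nearest_lattice_point (R : realType) (N : nat) (z : R) : (0 < N)%N ->
  0 <= z <= 1 -> exists m : 'I_N, `|N%:R * z - m%:R - 2^-1| <= 2^-1.
Proof.
move=> N0 /andP[z0 z1]; have NR : 0 < N%:R :> R by rewrite ltr0n.
have Nz0 : 0 <= N%:R * z by rewrite mulr_ge0.
have := Num.Theory.truncn_itv Nz0; set m := Num.truncn _ => /andP[m1 m2].
have NzN : N%:R * z <= N%:R by rewrite -[leRHS]mulr1 ler_pM2l.
have mN : (m <= N)%N by rewrite -(ler_nat R) (le_trans m1).
rewrite -addn1 natrD in m2.
have [mN'|mN'] := ltnP m N.
  by exists (Ordinal mN') => /=; rewrite ler_norml; lra.
(* This case is the right end [z = 1], where the last index [N.-1] is still within [1/2]. *)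
have mE : m = N by apply/eqP; rewrite eqn_leq mN.
have N1 : (N.-1 < N)%N by rewrite prednK.
have NE : N%:R = N.-1%:R + 1 :> R by rewrite natr1 prednK.
by exists (Ordinal N1); rewrite /= mE in m1 *; rewrite ler_norml; lra.
Qed.

(** In units of [1/N], the rounding of the path costs 2 and that of its endpoint at most [1/2]. *)
Lemma interpolation_error (R : realType) (N x k r z t : R) : 0 < N -> 0 <= t <= 1 ->
  `|x - (k + t * (r - k))| <= 2 -> `|N * z - r - 2^-1| <= 2^-1 ->
  `|(x + 1 - 2^-1) / N - ((k + 1 - 2^-1) / N + t * (z - (k + 1 - 2^-1) / N))|
    <= 5 / 2 / N.
Proof.
move=> N0 /andP[t0 t1] xk zr; rewrite -(ler_pM2r N0).
rewrite -[X in _ * X <= _](ger0_norm (ltW N0)) -normrM.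
rewrite (_ : 5 / 2 / N * N = 2 + 2^-1); last by field; rewrite gt_eqF.
set lhs := _ * N.
have -> : lhs = (x - (k + t * (r - k))) - t * (N * z - r - 2^-1).
  by rewrite /lhs; field; rewrite gt_eqF.
apply: le_trans (ler_normB _ _) _; rewrite lerD// normrM (ger0_norm t0).
by apply: le_trans zr; rewrite ler_piMl.
Qed.

(** * Linear descent of [g] along lattice paths *)

Section Descent.
Variables (R : realType) (kappa a A : R) (g : R * R -> R) (N : nat) (z0 : R * R).
Hypothesis kappa_ge1 : 1 <= kappa.
Hypothesis A_ge0 : 0 <= A.
Hypothesis a_ge0 : 0 <= a.
Hypothesis g_lipschitz : forall z z', in_unit_square z -> in_unit_square z' ->
  `|g z - g z'| <= A * enorm2 (z - z').
Hypothesis z0_in : in_unit_square z0.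
Hypothesis g_descent : forall (z : R * R) (t : R), in_unit_square z -> 0 <= t <= 1 ->
  a * t * enorm2 (z0 - z) <=
  g z - g (z.1 + t * (z0.1 - z.1), z.2 + t * (z0.2 - z.2)).
Hypothesis N_gt0 : (0 < N)%N.
Hypothesis A_le : A <= kappa * N%:R.
Hypothesis N_le : N%:R <= kappa * a.

Definition grid_point (k : 'I_N * 'I_N) : R * R :=
  ((k.1.+1%:R - 2^-1) / N%:R, (k.2.+1%:R - 2^-1) / N%:R).

Let N_gt0R : 0 < N%:R :> R. Proof. by rewrite ltr0n. Qed.

Lemma grid_point_in k : in_unit_square (grid_point k).
Proof.
have in01 (i : 'I_N) : 0 <= (i.+1%:R - 2^-1 : R) / N%:R <= 1.
  have iN : i.+1%:R <= N%:R :> R by rewrite ler_nat.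
  have i1 : 1 <= i.+1%:R :> R by rewrite ler1n.
  by rewrite ler_pdivlMr// ler_pdivrMr//; lra.
by split; apply: in01.
Qed.

Variable r : 'I_N * 'I_N.
Hypothesis r1_near : `|N%:R * z0.1 - r.1%:R - 2^-1| <= 2^-1.
Hypothesis r2_near : `|N%:R * z0.2 - r.2%:R - 2^-1| <= 2^-1.

Lemma grid_dist_enorm2 k :
  (grid_dist k r)%:R <= 2 * N%:R * enorm2 (z0 - grid_point k) + 1.
Proof.
have near1 (i m : 'I_N) (z : R) : `|N%:R * z - m%:R - 2^-1| <= 2^-1 ->
    (`|i - m|%N)%:R <= N%:R * `|z - (i.+1%:R - 2^-1) / N%:R| + 2^-1.
  move=> zm; rewrite -[X in X * _](ger0_norm (ltW N_gt0R)) -normrM.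
  have -> : N%:R * (z - (i.+1%:R - 2^-1) / N%:R) = N%:R * z - i%:R - 2^-1.
    by rewrite -addn1 natrD; field; rewrite gt_eqF.
  have -> : (`|i - m|%N)%:R = `|i%:R - m%:R| :> R.
    have [im|/ltnW mi] := leqP i m.
      by rewrite distnEr// natrB// distrC ger0_norm// subr_ge0 ler_nat.
    by rewrite distnEl// natrB// ger0_norm// subr_ge0 ler_nat.
  rewrite distrC; apply: le_trans (_ : _ <= `|N%:R * z - i%:R - 2^-1 - (N%:R * z - m%:R - 2^-1)|) _.
    by rewrite le_eqVlt; apply/orP; left; apply/eqP; congr `|_|; ring.
  by apply: le_trans (ler_normB _ _) _; rewrite lerD2l.
rewrite /grid_dist natrD.
have := near1 k.1 _ _ r1_near; have := near1 k.2 _ _ r2_near.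
have := ler_wpM2l (ltW N_gt0R) (norm1_le_enorm2 (z0 - grid_point k)).
rewrite /= mulrDr; lra.
Qed.

(** The [j]-th vertex lies within [5 / N] of a point [zt] of the segment to [z0]. The descent
    hypothesis acts at [zt]; passing to the vertex costs at most [5 * A / N <= 5 * kappa]. *)
Lemma lattice_path_descent k j : (j <= 2 * (grid_dist k r).+1)%N ->
  g (grid_point (lattice_path r k j)) <=
  g (grid_point k) - (j%:R - 5) / (4 * kappa) + 5 * kappa.
Proof.
set n := (grid_dist k r).+1 => jn.
have nR : 0 < n%:R :> R by rewrite ltr0n.
have jE := odd_double_half j.
have le_hn : (j./2 <= n)%N by lia.
have le_uhn : (uphalf j <= n)%N by rewrite uphalf_half; lia.
pose t : R := j./2%:R / n%:R.
have t01 : 0 <= t <= 1.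
  by rewrite divr_ge0//= ler_pdivrMr// mul1r ler_nat.
have kappa_gt0 : 0 < kappa := lt_le_trans ltr01 kappa_ge1.
pose z := grid_point k.
pose zt := (z.1 + t * (z0.1 - z.1), z.2 + t * (z0.2 - z.2)).
have zt_in : in_unit_square zt.
  have conv (x y : R) : 0 <= x <= 1 -> 0 <= y <= 1 -> 0 <= x + t * (y - x) <= 1.
    by move: t01 => /andP[? ?] /andP[? ?] /andP[? ?]; apply/andP; split; nra.
  by have [? ?] := grid_point_in k; have [? ?] := z0_in; split; apply: conv.
have close : enorm2 (grid_point (lattice_path r k j) - zt) <= 5 / N%:R.
  apply: le_trans (enorm2_le_norm1 _) _.
  rewrite (_ : 5 / N%:R = 5 / 2 / N%:R + 5 / 2 / N%:R); last by field; rewrite gt_eqF.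
  rewrite /= -!(addn1 (nat_of_ord _)) !natrD lattice_path1E lattice_path2E.
  apply: lerD.
    apply: (interpolation_error (r := r.1%:R)) => //; apply: lattice_line_approx => //.
      exact: grid_dist1_lt.
    by rewrite uphalf_half; lia.
  apply: (interpolation_error (r := r.2%:R)) => //; apply: lattice_line_approx => //.
    exact: grid_dist2_lt.
  by rewrite leqnn leqnSn.
have lip := le_trans (ler_norm _) (g_lipschitz (grid_point_in (lattice_path r k j)) zt_in).
have desc := g_descent (grid_point_in k) t01.
have A5 : A * enorm2 (grid_point (lattice_path r k j) - zt) <= 5 * kappa.
  apply: le_trans (ler_wpM2l A_ge0 close) _.
  by rewrite mulrA ler_pdivrMr//; have := A_le; lra.
(* With [e = enorm2 (z0 - z)]: [j <= 1 + 2 * t * n] and [n <= 2 * N * e + 2] give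
   [j <= 5 + 4 * t * N * e]; then use [N <= kappa * a]. *)
have at_ge : (j%:R - 5) / (4 * kappa) <= a * t * enorm2 (z0 - z).
  rewrite ler_pdivrMr ?mulr_gt0//.
  have e0 : 0 <= enorm2 (z0 - z) by exact: sqrtr_ge0.
  have d := grid_dist_enorm2 k; rewrite -/z in d.
  have nE : n%:R = (grid_dist k r)%:R + 1 :> R by rewrite /n -addn1 natrD.
  have tn : t * n%:R = j./2%:R by rewrite /t divfK// gt_eqF.
  have jR : j%:R <= 1 + 2 * j./2%:R :> R.
    by rewrite -natrM nat1r ler_nat mul2n -[leqLHS]jE -add1n leq_add2r leq_b1.
  have /andP[t0 t1] := t01.
  have te0 : 0 <= t * enorm2 (z0 - z) by rewrite mulr_ge0.
  have s1 : t * (n%:R - 2) <= t * (2 * N%:R * enorm2 (z0 - z)).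
    by rewrite ler_wpM2l//; lra.
  have s2 := ler_wpM2r te0 N_le.
  lra.
rewrite -/z -/zt in desc lip *; lra.
Qed.

End Descent.

(** * Poincare inequality for the Metropolis chain, and conclusion *)

Section MetropolisPoincare.
Variables (R : realType) (N : nat) (f : R * R -> R) (r : 'I_N * 'I_N) (E c : R).
Hypothesis f_gt0 : forall k, 0 < @grid_fun R N f k.
Hypothesis E_ge0 : 0 <= E.
Hypothesis c_gt0 : 0 < c.
Hypothesis f_decay : forall k j, (j <= 2 * (grid_dist k r).+1)%N ->
  grid_fun f k <= E * expR (- (c * j%:R)) * grid_fun f (lattice_path r k j).

(** The decay [expR (- (c * j))] is [q] to the power [4 * j]. Half of it feeds [path_poincare]; the
    other half is at most [q ^+ 2] to the power [grid_dist k v], because [v] is within distance [j]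
    of [k], and this is summable in each coordinate. The [4] undoes the proposal probability. *)
Lemma metropolis_poincare (h : 'I_N * 'I_N -> R) (q := expR (- (c / 4))) :
  \sum_k grid_fun f k * (h k - h r) ^+ 2 <=
  4 * E * (2 / (1 - q ^+ 2)) ^+ 2 / (1 - q) ^+ 2 *
  \sum_k \sum_l grid_fun f k * metropolis f k l * (h k - h l) ^+ 2.
Proof.
have q_gt0 : 0 < q := expR_gt0 _.
have q_lt1 : q < 1 by rewrite expR_lt1 oppr_lt0 divr_gt0.
have q2_gt0 : 0 < q ^+ 2 by rewrite exprn_gt0.
have q2_lt1 : q ^+ 2 < 1 by rewrite exprn_ilt1 ?ltW.
have qE j : expR (- (c * j%:R)) = q ^+ j ^+ 2 * q ^+ j ^+ 2.
  by rewrite /q -!expRM_natl -expRD; congr expR; field.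
(* Since [grid_dist k r < 2 * N], every path has reached [r] by time [4 * N]. *)
apply: (@path_poincare R _ (grid_fun f) (fun k l => grid_fun f k * metropolis f k l)
  (fun k l => q ^+ 2 ^+ `|k.1 - l.1|%N * q ^+ 2 ^+ `|k.2 - l.2|%N)
  (lattice_path r) r (4 * N) (_ ^+ 2) (4 * E) q) => //.
- exact: mulr_ge0.
- by move=> k; exact: ltW.
- by move=> k l; rewrite mulr_ge0 ?metropolis_ge0// ltW.
- by move=> k l; rewrite mulr_ge0// exprn_ge0 ?ltW.
- move=> v; rewrite -(pair_bigA _ (fun i i' : 'I_N =>
    q ^+ 2 ^+ `|i - v.1|%N * q ^+ 2 ^+ `|i' - v.2|%N))/=.
  under eq_bigr do rewrite -mulr_sumr.
  rewrite -mulr_suml expr2 ler_pM ?two_sided_geometric_sum//.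
  + by apply: sumr_ge0 => i _; rewrite exprn_ge0 ?ltW.
  + by apply: sumr_ge0 => i _; rewrite exprn_ge0 ?ltW.
- exact: lattice_path0.
- move=> k; apply: lattice_path_end; have := grid_dist_lt r k; lia.
move=> k j _ moving.
have jn : (j < 2 * (grid_dist k r).+1)%N.
  rewrite ltnNge; apply: contraNN moving => nj.
  by rewrite !lattice_path_end// leqW.
have adjacent : grid_dist (lattice_path r k j) (lattice_path r k j.+1) = 1%N.
  have := lattice_path_step r k j; rewrite leq_eqVlt => /orP[/eqP//|].
  by rewrite ltnS leqn0 => /eqP/grid_dist_eq0 e; rewrite e eqxx in moving.
rewrite (metropolis_flow f_gt0 adjacent) -exprD.
set v := lattice_path r k j; set v' := lattice_path r k j.+1.
apply: (@le_trans _ _ (E * expR (- (c * j%:R)) * Num.min (grid_fun f v) (grid_fun f v'))).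
  have decay0 : 0 <= E * expR (- (c * j%:R)) by rewrite mulr_ge0 ?expR_ge0.
  rewrite (minr_pMr _ _ decay0) le_min; apply/andP; split.
    exact: f_decay (ltnW jn).
  (* The decay at [j.+1] is weakened to that at [j], so that both endpoints share one factor. *)
  apply: le_trans (f_decay jn) _; rewrite ler_wpM2r ?(ltW (f_gt0 _))// ler_wpM2l//.
  by rewrite ler_expR lerN2 ler_wpM2l ?(ltW c_gt0)// ler_nat.
have dist_le : q ^+ j ^+ 2 <= q ^+ 2 ^+ (`|k.1 - v.1| + `|k.2 - v.2|)%N.
  by rewrite -exprM mulnC exprM ler_wiXn2l ?ltW// lattice_path_dist.
have min_ge0 : 0 <= Num.min (grid_fun f v) (grid_fun f v').
  by rewrite le_min !ltW.
rewrite qE [leRHS](_ : _ = E * (q ^+ j ^+ 2 * q ^+ 2 ^+ (`|k.1 - v.1| + `|k.2 - v.2|)%N)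
  * Num.min (grid_fun f v) (grid_fun f v')); last by field.
by rewrite ler_wpM2r// ler_wpM2l// ler_wpM2l// exprn_ge0// exprn_ge0// ltW.
Qed.

End MetropolisPoincare.

Theorem proposition3p2 (R : realType) (C kappa : R)
    (hC : 1 <= C) (hkappa : 1 <= kappa) :
  exists c1 c2 : R, [/\ 0 < c1, c1 <= c2 &
    forall (a A : R) (g : R * R -> R) (N : nat),
      0 < a -> a <= A ->
      (forall z z', in_unit_square z -> in_unit_square z' ->
         `|g z - g z'| <= A * enorm2 (z - z')) ->
      (exists z0, [/\ in_unit_square z0, g z0 = 0 &
         forall (z : R * R) (t : R), in_unit_square z -> 0 <= t <= 1 ->
           a * t * enorm2 (z0 - z) <=
             g z - g (z.1 + t * (z0.1 - z.1), z.2 + t * (z0.2 - z.2))]) ->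
      A / a <= C ->
      (2 <= N)%N -> kappa^-1 * A <= N%:R -> N%:R <= kappa * a ->
      c1 <= spectral_gap (@metropolis R N (fun z => expR (- g z))) <= c2].
Proof.
have kappa_gt0 : 0 < kappa := lt_le_trans ltr01 hkappa.
(* Exponentiating [lattice_path_descent] gives the rate [c], with its additive constants collected
   in [E]. *)
pose c := (4 * kappa)^-1; pose E := expR (5 * c + 5 * kappa).
have c_gt0 : 0 < c by rewrite invr_gt0 mulr_gt0.
pose q := expR (- (c / 4)).
pose K := 4 * E * (2 / (1 - q ^+ 2)) ^+ 2 / (1 - q) ^+ 2.
have q_lt1 : q < 1 by rewrite expR_lt1 oppr_lt0 divr_gt0.
have K_gt0 : 0 < K.
  have B_gt0 : 0 < 2 / (1 - q ^+ 2).
    by rewrite divr_gt0// subr_gt0 exprn_ilt1 ?expR_ge0.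
  by rewrite divr_gt0 ?exprn_gt0 ?subr_gt0// mulr_gt0 ?exprn_gt0// mulr_gt0 ?expR_gt0.
exists (Num.min 1 (2 * K)^-1), 2; split.
- by rewrite lt_min ltr01 invr_gt0 mulr_gt0.
- by rewrite ge_min ler1n.
move=> a A g N a_gt0 aA lip [z0 [z0_in _ desc]] _ N2 AN Na.
have N_gt0 : (0 < N)%N := ltnW N2.
have A_le : A <= kappa * N%:R by rewrite -ler_pdivrMl.
have f_gt0 (k : 'I_N * 'I_N) : 0 < grid_fun (fun z => expR (- g z)) k := expR_gt0 _.
rewrite stochastic_spectral_gap_le2 ?andbT; last first.
- exact: metropolis_row.
- exact: metropolis_ge0.
have [[/(nearest_lattice_point N_gt0)[r1 r1_near]]] := z0_in.
move=> /(nearest_lattice_point N_gt0)[r2 r2_near].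
apply: (@spectral_gap_poincare _ _ _ _ _ (grid_fun (fun z => expR (- g z))) K (r1, r2)) => //.
- exact: metropolis_ge0.
- exact: metropolis_row.
- exact: metropolis_grid_fun_reversible.
move=> h; apply: metropolis_poincare => //; first exact: expR_ge0.
move=> k j jn; rewrite /grid_fun -!expRD ler_expR -/(grid_point _ _).
have := @lattice_path_descent R kappa a A g N z0 hkappa (ltW (lt_le_trans a_gt0 aA))
  (ltW a_gt0) lip z0_in desc N_gt0 A_le Na (r1, r2) r1_near r2_near k j jn.
rewrite /grid_point /c mulrBl; lra.
Qed.
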